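(* Every alternate module is subsymplectic. That is, for every finite abelian group $A$ and every $\mathbb{Z}$-bilinear map $\phi:A\times A\to\mathbb{Q}/\mathbb{Z}$ with $\phi(a,a)=0$ for all $a\in A$, there exist an abelian group $B$ of order $n_{A,\phi}$ and an injective group homomorphism $\iota:A\to B\times B^*$ such that $\omega_B(\iota(a),\iota(a'))=\phi(a,a')$ for all $a,a'\in A$, where $\omega_B$ is the standard symplectic form on $B\times B^*$.
   Context: An alternate module $(A,\phi)$ is a finite abelian group $A$ together with a $\mathbb{Z}$-bilinear map $\phi:A\times A\to\mathbb{Q}/\mathbb{Z}$ such that $\phi(a,a)=0$ for all $a\in A$. For a subset $S\subseteq A$, $S^\perp=\{a\in A:\phi(a,s)=0\ \text{for all } s\in S\}$. The kernel is $K_\phi=A^\perp=\{a\in A:\phi(a,b)=0\ \text{for all } b\in A\}$. A Lagrangian is a subset $L\subseteq A$ with $L=L^\perp$; all Lagrangians of $(A,\phi)$ have the same cardinality, denoted $n_{A,\phi}=\sqrt{|A||K_\phi|}$. For a finite abelian group $B$, $B^*=\mathrm{Hom}(B,\mathbb{Q}/\mathbb{Z})$, and the standard symplectic module $B\times B^*$ carries the form $\omega_B((b_1,\psi_1),(b_2,\psi_2))=\psi_2(b_1)-\psi_1(b_2)$. $(A,\phi)$ is called subsymplectic if there exists an abelian group $B$ of order $n_{A,\phi}$ such that $(A,\phi)$ is included in the standard symplectic module $B\times B^*$ (via an injective group homomorphism compatible with the forms). *)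

(* Defs.v *)
From HB Require Import structures.
From mathcomp Require Import all_boot all_order all_algebra.
From mathcomp Require Import all_fingroup all_solvable.

Set Implicit Arguments.
Unset Strict Implicit.
Unset Printing Implicit Defensive.

Import Order.TTheory GRing.Theory Num.Theory.
Local Open Scope ring_scope.

(* [x \in intQ] is convertible to [x \is a Num.int]; the clone only exposes the
   canonical structure that [Quotient.quot] needs. *)
Definition intQ := GRing.ZmodClosed.clone rat (@Num.int_num_subdef rat) _.

Definition QZ := Quotient.quot intQ.
HB.instance Definition _ := GRing.Zmodule.on QZ.

Section Dual.
Variable B : finZmodType.

Definition is_hom (f : {ffun B -> QZ}) : bool :=
  [forall x, forall y, f (x + y) == f x + f y].

Lemma is_homP (f : {ffun B -> QZ}) : reflect {morph f : x y / x + y} (is_hom f).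
Proof.
apply: (iffP forallP) => [h x y|h x]; last by apply/forallP=> y; rewrite h.
by have /forallP/(_ y)/eqP := h x.
Qed.

Fact is_hom_zmod_closed : zmod_closed is_hom.
Proof.
split=> [|f g /is_homP hf /is_homP hg]; apply/is_homP=> x y.
  by rewrite !ffunE addr0.
by rewrite !ffunE hf hg opprD addrACA.
Qed.
HB.instance Definition _ :=
  GRing.isZmodClosed.Build {ffun B -> QZ} is_hom is_hom_zmod_closed.

(* A sub-Z-module of {ffun B -> QZ}, rather than {additive B -> QZ}, so as to
   inherit the pointwise group structure. *)
Record dual := Dual { dual_fun :> {ffun B -> QZ}; _ : is_hom dual_fun }.
HB.instance Definition _ := [isSub for dual_fun].
HB.instance Definition _ := [Choice of dual by <:].
HB.instance Definition _ := [SubChoice_isSubZmodule of dual by <:].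

Definition omega (u v : B * dual) : QZ := v.2 u.1 - u.2 v.1.

End Dual.

Section AlternateModule.
Variables (A : finZmodType) (phi : A -> A -> QZ).

Definition biadditive : Prop :=
  (forall x y z, phi (x + y) z = phi x z + phi y z) /\
  (forall x y z, phi x (y + z) = phi x y + phi x z).

Definition is_alternate : Prop := biadditive /\ forall a, phi a a = 0.

Definition perp (S : {set A}) : {set A} :=
  [set a | [forall s in S, phi a s == 0]].

Definition kernel : {set A} := perp setT.

Definition lagrangian (L : {set A}) : bool := L == perp L.

(* The common cardinality of the Lagrangians of (A, phi): see
   [lagrangian_exists] and [lagr_order_lagrangian], and [lagr_order_sqrt] for
   its value, the square root of #|A| * #|kernel|. *)
Definition lagr_order : nat := \max_(L : {set A} | lagrangian L) #|L|.

Definition subsymplectic : Prop :=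
  exists2 B : finZmodType, #|B| = lagr_order &
  exists2 iota : {additive A -> B * dual B}, injective iota &
    forall a a' : A, omega (iota a) (iota a') = phi a a'.

End AlternateModule.

Lemma QZ_torsion_count (m : nat) (s : seq QZ) :
  (0 < m)%N -> uniq s -> {in s, forall t, t *+ m = 0} -> (size s <= m)%N.
Proof.
move=> m_gt0 us sm.
pose p (x : rat) : QZ := \pi_(Quotient.quot intQ)%qT x.
have pD : {morph p : x y / x + y} by move=> x y; rewrite /p; exact: raddfD.
have p0 : p 0 = 0 by rewrite /p; exact: raddf0.
have pM x n : p x *+ n = p (x *+ n).
  by elim: n => [|n IH]; rewrite ?mulr0n // !mulrS IH pD.
have peq x y : (p x == p y) = (x - y \is a Num.int).
  by have := Quotient.idealrBE intQ x y; rewrite /= => <-.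
rewrite -[leqRHS](size_mkseq (fun k : nat => p (k%:R / m%:R))).
apply: uniq_leq_size => // t /sm.
have -> : t = p (generic_quotient.repr t) by rewrite /p reprK.
move: (generic_quotient.repr t) => x {t}; rewrite pM -p0 => /eqP.
rewrite peq subr0 => /intrP[z xz].
have mr : (m%:R : rat) != 0 by rewrite pnatr_eq0 -lt0n.
have mz : (m%:Z != 0)%R by rewrite -lt0n.
have [k km zk] : exists2 k : nat, (k < m)%N & (z %% m%:Z)%Z = k.
  exists `|(z %% m%:Z)%Z|%N; last by rewrite gez0_abs // modz_ge0.
  by rewrite -ltz_nat gez0_abs ?modz_ge0 // ltz_mod.
apply/mapP; exists k; first by rewrite mem_iota.
apply/eqP; rewrite peq; apply/intrP; exists (z %/ m%:Z)%Z.
have -> : x = z%:~R / m%:R by rewrite -xz -[x *+ m]mulr_natr mulfK.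
rewrite {1}(divz_eq z m%:Z) zk intrD intrM -[(Posz m)%:~R]/(m%:R) -[(Posz k)%:~R]/(k%:R).
by rewrite mulrDl mulfK // addrK.
Qed.

Lemma hom_count (A : finZmodType) (H : {group A}) (I : finType)
    (f : I -> A -> QZ) (N : {group A}) :
  N \subset H ->
  (forall i, {in H &, {morph f i : x y / x + y}}) ->
  (forall i, {in N, forall x, f i x = 0}) ->
  (forall i j, {in H, f i =1 f j} -> i = j) ->
  (#|I| * #|N| <= #|H|)%N.
Proof.
have [n] := ubnP (#|H| - #|N|); elim: n => // n IHn in I f N *.
move=> ltn sNH fD fN finj.
have [sHN|/subsetPn[x Hx Nx]] := boolP (H \subset N).
  have I1 : (#|I| <= 1)%N.
    apply/card_le1_eqP=> i j _ _; apply: finj => y Hy.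
    by rewrite !fN // (subsetP sHN).
  by rewrite -[leqRHS]mul1n leq_mul // subset_leq_card.
have nNA (y : A) : y \in 'N(N)%g.
  by apply: (subsetP (sub_abelian_norm (FinRing.zmod_abelian [set: A]) (subsetT _))); rewrite inE.
pose M := (<[x]> <*> N)%G.
have sNM : N \subset M by rewrite joing_subr.
have Mx : x \in M by rewrite (subsetP (joing_subl _ _)) // cycle_id.
have sMH : M \subset H by rewrite join_subG cycle_subG Hx sNH.
have ltNM : (#|N| < #|M|)%N by apply: proper_card; rewrite properE sNM; apply/subsetPn; exists x.
pose m := #|M : N|%g.
have m_gt0 : (0 < m)%N by exact: indexg_gt0.
have xm : x *+ m \in N.
  apply: coset_idr; first exact: nNA.
  rewrite -FinRing.zmodXgE morphX ?nNA //.
  have -> : m = #|M / N|%g by rewrite card_quotient //; apply/subsetP=> y _; exact: nNA.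
  by rewrite expg_cardG // mem_quotient.
have f0 i : f i 0 = 0 by apply: fN; exact: group1.
have Hn y k : y \in H -> y *+ k \in H by move=> ?; rewrite -FinRing.zmodXgE groupX.
have fMn i y k : y \in H -> f i (y *+ k) = f i y *+ k.
  move=> Hy; elim: k => [|k IHk]; first by rewrite !mulr0n.
  by rewrite !mulrS fD ?Hn // IHk.
have HB y : y \in H -> - y \in H by move=> ?; rewrite -FinRing.zmodVgE groupV.
have fB i : {in H, {morph f i : y / - y}}.
  move=> y Hy; apply/eqP; rewrite -addr_eq0 -fD ?HB // addNr f0 //.
pose T := undup [seq f i x | i : I].
have szT : (size T <= m)%N.
  apply: QZ_torsion_count => //; first exact: undup_uniq.
  move=> t; rewrite mem_undup => /mapP[i _ ->].
  by rewrite -fMn // fN.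
have cls t : (#|[set i | f i x == t]| * #|M| <= #|H|)%N.
  have [->|[i0]] := set_0Vmem [set i | f i x == t]; first by rewrite cards0.
  rewrite inE => /eqP ft.
  rewrite -card_sig.
  apply: (IHn _ (fun (i : {i | i \in [set i | f i x == t]}) y => f (val i) y - f i0 y)).
  - by apply: leq_trans (ltn_sub2l _ ltNM) _ => //; apply: leq_trans ltNM (subset_leq_card sMH).
  - by [].
  - by move=> i y z Hy Hz /=; rewrite !fD // opprD addrACA.
  - move=> i y; rewrite /M /= norm_joinEl; last by apply/subsetP=> ? _; exact: nNA.
    case/mulsgP=> _ z /cycleP[k ->] Nz ->.
    have Hz : z \in H by rewrite (subsetP sNH).
    rewrite FinRing.zmodXgE FinRing.zmodMgE !fD ?Hn // !(fN _ z) // !addr0 !fMn //.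
    by have := valP i; rewrite inE ft => /eqP ->; rewrite subrr.
  - move=> i j eqij; apply: val_inj; apply: finj => y /eqij /=; exact: addIr.
have cI : (#|I| <= \sum_(t <- T) #|[set i | f i x == t]|)%N.
  rewrite -sum1_card (eq_bigr (fun t => \sum_(i : I | f i x == t) 1)%N); last first.
    by move=> t _; rewrite -sum1_card; apply: eq_bigl => i; rewrite inE.
  rewrite (exchange_big_dep predT) //=; apply: leq_sum => i _.
  rewrite sum1_count -has_count; apply/hasP; exists (f i x) => //.
  by rewrite mem_undup; apply/mapP; exists i; rewrite ?mem_enum.
have le : (#|I| * #|M| <= m * #|H|)%N.
  apply: leq_trans (leq_mul cI (leqnn _)) _; rewrite big_distrl /=.
  apply: leq_trans (leq_sum _ (fun t _ => cls t)) _.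
  by rewrite big_const_seq count_predT iter_addn_0 mulnC leq_mul.
rewrite -(leq_pmul2l m_gt0) (leq_trans _ le) // mulnCA [(m * _)%N]mulnC Lagrange //.
Qed.

Section Lagrangian.
Variables (A : finZmodType) (phi : A -> A -> QZ).
Hypothesis phiP : is_alternate phi.

Let phiDl x y z : phi (x + y) z = phi x z + phi y z.
Proof. exact: phiP.1.1. Qed.
Let phiDr x y z : phi x (y + z) = phi x y + phi x z.
Proof. exact: phiP.1.2. Qed.
Let phi_alt a : phi a a = 0. Proof. exact: phiP.2. Qed.

Lemma alternate_antisym a b : phi a b = - phi b a.
Proof.
apply/eqP; rewrite -addr_eq0; apply/eqP.
by have := phi_alt (a + b); rewrite phiDl !phiDr !phi_alt add0r addr0.
Qed.

Lemma perpP (S : {set A}) a : reflect {in S, forall s, phi a s = 0} (a \in perp phi S).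
Proof. by rewrite inE; apply: (iffP forall_inP) => h s /h /eqP. Qed.

Lemma perp_group_set (S : {set A}) : group_set (perp phi S).
Proof.
apply/group_setP; split.
  apply/perpP=> s _; apply: (addrI (phi 0 s)).
  by rewrite -phiDl !addr0.
by move=> x y /perpP xS /perpP yS; apply/perpP=> s Ss; rewrite phiDl xS ?yS ?addr0.
Qed.

Lemma lagrangian_exists : exists L, lagrangian phi L.
Proof.
have [L /maxsetP[isoL maxL] _] := @maxset_exists _ (fun S => S \subset perp phi S) set0 (sub0set _).
exists L; rewrite /lagrangian eqEsubset isoL /=.
apply/subsetP=> a /perpP aL.
rewrite -(maxL (a |: L)) ?setU11 ?subsetUr //.
apply/subsetP=> x xaL; apply/perpP=> y yaL.
move: xaL yaL; rewrite !inE => /orP[/eqP->|xL] /orP[/eqP->|yL] //.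
- exact: aL.
- by rewrite alternate_antisym aL ?oppr0.
by have /perpP := subsetP isoL _ xL; apply.
Qed.

Lemma pairing_card (P Q H N : {group A}) :
  N \subset H -> Q \subset P ->
  {in P & N, forall a x, phi a x = 0} ->
  {in P, forall a, (a \in Q) = [forall x in H, phi a x == 0]} ->
  (#|P| * #|N| <= #|Q| * #|H|)%N.
Proof.
move=> sNH sQP PN0 QE.
have nQA (y : A) : y \in 'N(Q)%g.
  by apply: (subsetP (sub_abelian_norm (FinRing.zmod_abelian [set: A]) (subsetT _))); rewrite inE.
have PQ c : c \in (P / Q)%g -> repr c \in P.
  case/morphimP=> x Nx Px ->; apply: (subsetP (_ : coset Q x \subset P)).
    by rewrite val_coset // mul_subG ?sub1set.
  exact: mem_repr_coset.
have := @hom_count A H {c | c \in (P / Q)%g} (fun c => phi (repr (val c))) N sNH.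
have nQP : P \subset 'N(Q)%g by apply/subsetP=> y _; exact: nQA.
rewrite card_sig (card_quotient nQP) => hc.
 rewrite -(Lagrange sQP) -mulnA leq_mul2l; apply/orP; right; apply: hc.
- by move=> c x y _ _; exact: phiDr.
- by move=> [c Pc] x Nx /=; apply: PN0 => //; exact: PQ.
move=> [c Pc] [d Pd] /= cd; apply: val_inj => /=.
rewrite -(coset_reprK c) -(coset_reprK d).
have -> : repr c = (repr c - repr d) + repr d by rewrite subrK.
have PcN : repr c - repr d \in P by rewrite -FinRing.zmodMgE -FinRing.zmodVgE groupM ?groupV ?PQ.
apply: coset_kerl; rewrite QE //; apply/forall_inP=> x Hx.
apply/eqP/(addIr (phi (repr d) x)).
by rewrite -phiDl subrK cd // add0r.
Qed.

Lemma lagrangian_card (L : {set A}) :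
  lagrangian phi L -> (#|L| ^ 2 = #|A| * #|kernel phi|)%N.
Proof.
move=> /eqP LE.
pose G := Group (perp_group_set L); pose K := Group (perp_group_set setT).
have sGA : G \subset [set: A]%G by rewrite subsetT.
have memL a : (a \in G) = [forall x in L, phi a x == 0] by rewrite inE.
have memK a : (a \in K) = [forall x in [set: A], phi a x == 0] by rewrite inE.
have GL : G = L :> {set A} by rewrite /= -LE.
have sKG : K \subset G.
  by apply/subsetP=> a /perpP aK; apply/perpP=> s _; apply: aK; rewrite inE.
rewrite -cardsT -GL; apply/eqP; rewrite eqn_leq; apply/andP; split.
  rewrite [leqRHS]mulnC; apply: (@pairing_card G K [set: A]%G G) => //.
  by move=> a x /perpP aL Gx; apply: aL; rewrite -GL.
apply: (@pairing_card [set: A]%G G G K) => //.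
  move=> a x _ /perpP xK; rewrite alternate_antisym xK ?inE ?oppr0 //.
by move=> a _; rewrite memL GL.
Qed.

Lemma lagr_order_lagrangian (L : {set A}) : lagrangian phi L -> #|L| = lagr_order phi.
Proof.
move=> lagL; rewrite /lagr_order.
apply/eqP; rewrite eqn_leq; apply/andP; split.
  by apply: (@leq_bigmax_cond _ _ (fun M : {set A} => #|M|)).
apply/bigmax_leqP=> M lagM.
by rewrite -leq_sqr !lagrangian_card.
Qed.

Lemma lagr_order_sqrt : (lagr_order phi ^ 2 = #|A| * #|kernel phi|)%N.
Proof.
by have [L lagL] := lagrangian_exists; rewrite -(lagr_order_lagrangian lagL) lagrangian_card.
Qed.

End Lagrangian.

(* Main.v *)
(** Let K be the kernel of (A, phi).  If K is nontrivial, pick a prime p dividing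
    #|K|, an element x of K outside pK and a character chi of A killing pK but
    not x.  Then p chi kills K, so that p chi = phi(a0, -) for some a0; moving a0
    by a multiple of x one may assume chi(a0) = 0.  Adjoining y with p y = a0 and
    phi(y, -) = chi yields an alternate module whose order is multiplied by p and
    whose kernel is divided by p.  By induction A embeds in a nondegenerate
    alternate module W of order #|A| #|K|.  A nondegenerate module is a direct
    sum of two Lagrangians L and M: take a pair of isotropic subgroups in perfect
    duality with L maximal; if its orthogonal were nontrivial, it would contain
    two more elements x, y spanning a hyperbolic plane.  The duality between L
    and M identifies W isometrically with L * L^*. *)
Require Import Defs.
From HB Require Import structures.
From mathcomp Require Import all_boot all_order all_algebra.
From mathcomp Require Import all_fingroup all_solvable all_field all_character.

Set Implicit Arguments.
Unset Strict Implicit.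
Unset Printing Implicit Defensive.

Import Order.TTheory GRing.Theory Num.Theory.
Local Open Scope ring_scope.


(** * Additive maps and torsion *)

Lemma morphD_morph0 (U V : zmodType) (f : U -> V) :
  {morph f : x y / x + y} -> f 0 = 0.
Proof. by move=> fD; apply: (addrI (f 0)); rewrite -fD !addr0. Qed.

Lemma morphD_morphN (U V : zmodType) (f : U -> V) :
  {morph f : x y / x + y} -> {morph f : x / - x}.
Proof.
by move=> fD x; apply/eqP; rewrite -addr_eq0 -fD addNr (morphD_morph0 fD).
Qed.

Lemma morphD_morphMn (U V : zmodType) (f : U -> V) k :
  {morph f : x y / x + y} -> {morph f : x / x *+ k}.
Proof.
move=> fD x; elim: k => [|k IHk]; first by rewrite !mulr0n (morphD_morph0 fD).
by rewrite !mulrS fD IHk.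
Qed.

Lemma torsion_gcdn (V : zmodType) m n (t : V) :
  t *+ m = 0 -> t *+ n = 0 -> t *+ gcdn m n = 0.
Proof.
have [->|m_gt0] := posnP m; first by rewrite gcd0n.
move=> tm tn; have [a b eqab _] := egcdnP n m_gt0.
move/(congr1 (fun k => t *+ k)): eqab.
by rewrite mulrnDr ![(_ * m)%N]mulnC ![(_ * n)%N]mulnC !mulrnA tm tn !mul0rn add0r.
Qed.

Lemma coprime_torsion0 (V : zmodType) m n (t : V) :
  coprime m n -> t *+ m = 0 -> t *+ n = 0 -> t = 0.
Proof. by move=> /eqP co tm /(torsion_gcdn tm); rewrite co. Qed.

(** The gcd of [i] and [p ^ k.+1] is a power of [p] that kills [t]; as [p ^ k] does not, it is
    [p ^ k.+1] itself. *)
Lemma prime_power_torsion_dvdn (V : zmodType) p k i (t : V) :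
  prime p -> t *+ (p ^ k.+1) = 0 -> t *+ (p ^ k) != 0 -> t *+ i = 0 ->
  (p ^ k.+1 %| i)%N.
Proof.
move=> pr_p tp ntp ti; have tg := torsion_gcdn ti tp.
have /(dvdn_pfactor _ _ pr_p)[f le_fk eq_g] := dvdn_gcdr i (p ^ k.+1).
have [lt_kf|le_f] := ltnP k f.
  by rewrite (dvdn_trans (dvdn_exp2l p lt_kf)) // -eq_g dvdn_gcdl.
case/eqP: ntp; rewrite -(subnKC le_f) expnD mulrnA -eq_g tg mul0rn //.
Qed.

Lemma finzmod_norm (A : finZmodType) (N G : {group A}) : G \subset 'N(N)%g.
Proof.
exact: subset_trans (subsetT G)
  (sub_abelian_norm (FinRing.zmod_abelian [set: A]) (subsetT N)).
Qed.

(** * Characters with values in Q/Z *)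

Definition QZfrac (n k : nat) : QZ := \pi_QZ%qT (k%:R / n%:R : rat).

Lemma QZfracD n : {morph QZfrac n : j k / (j + k)%N >-> j + k}.
Proof. by move=> j k; rewrite /QZfrac natrD mulrDl; apply: raddfD. Qed.

Lemma eq_QZfrac n j k :
  (0 < n)%N -> (QZfrac n j == QZfrac n k) = (j == k %[mod n]).
Proof.
move=> n_gt0; have nr : (n%:R : rat) != 0 by rewrite pnatr_eq0 -lt0n.
have -> : (QZfrac n j == QZfrac n k) =
    ((j%:R / n%:R - k%:R / n%:R : rat) \is a Num.int).
  by have := Quotient.idealrBE intQ (j%:R / n%:R : rat) (k%:R / n%:R : rat);
    rewrite /= => <-.
rewrite -mulrBl.
have -> : (j == k %[mod n]) = (j%:Z == k%:Z %[mod n%:Z])%Z by rewrite !modz_nat.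
rewrite eqz_mod_dvd.
apply/intrP/dvdzP => [[z]|[z jk]].
  move/(canRL (divfK nr)) => jk; exists z; apply: (@intr_inj rat).
  by rewrite rmorphB rmorphM /= -jk.
exists z; apply: (canLR (mulfK nr)).
by have /(congr1 (fun i : int => i%:~R : rat)) := jk; rewrite rmorphB rmorphM.
Qed.

(* A linear character of A / N with values in the #|A|-th roots of unity, composed
   with the discrete logarithm z^k |-> k / #|A|. *)
Lemma separating_character (A : finZmodType) (N : {group A}) (x : A) :
  x \notin N ->
  exists chi : A -> QZ, [/\ {morph chi : a b / a + b},
    {in N, forall a, chi a = 0} & chi x != 0].
Proof.
move=> Nx; pose G := [set: A]%G.
have nNA (y : A) : y \in 'N(N)%g by apply: (subsetP (finzmod_norm N G)); rewrite inE.
have abGN : abelian (G / N)%g by apply/quotient_abelian/FinRing.zmod_abelian.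
have GN (y : A) : coset N y \in (G / N)%g by rewrite mem_quotient ?inE.
have [i chi_x] : exists i : Iirr (G / N)%g, coset N x \notin cfker 'chi_i.
  apply/existsP; apply: contraR Nx; rewrite negb_exists => /forallP Kx.
  apply: coset_idr => //; apply/set1gP; rewrite -(TI_cfker_irr (G / N)%g).
  by apply/bigcapP=> i _; have := Kx i; rewrite negbK.
have lin_i := (char_abelianP _ abGN) i.
pose lam (a : A) := 'chi_i (coset N a).
have lamM a b : lam (a + b) = lam a * lam b.
  by rewrite /lam -lin_charM // -morphM.
have lam1 : lam 0 = 1 by rewrite /lam -[0]/(1%g : A) morph1 lin_char1.
have lamX a k : lam (a *+ k) = lam a ^+ k.
  by elim: k => [|k IHk]; rewrite ?mulr0n // mulrS exprS lamM IHk.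
have n_gt0 : (0 < #|G|)%N by apply: cardG_gt0.
have [z prim_z] := C_prim_root_exists n_gt0.
have lamG a : lam a ^+ #|G| = 1.
  by rewrite -lamX -FinRing.zmodXgE expg_cardG ?inE.
pose log a := sval (prim_rootP prim_z (lamG a)).
have logP a : lam a = z ^+ log a by rewrite /log; case: prim_rootP.
have lam_eq1 a : (QZfrac #|G| (log a) == 0) = (lam a == 1).
  have -> : 0 = QZfrac #|G| 0 :> QZ.
    by apply: (addrI (QZfrac #|G| 0)); rewrite -QZfracD !addr0.
  by rewrite eq_QZfrac // -(eq_prim_root_expr prim_z) -logP.
exists (fun a => QZfrac #|G| (log a)); split.
- move=> a b; apply/eqP; rewrite -QZfracD eq_QZfrac // -(eq_prim_root_expr prim_z).
  by rewrite exprD -!logP lamM.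
- by move=> a Na; apply/eqP; rewrite lam_eq1 /lam coset_id // lin_char1.
rewrite lam_eq1; apply: contra chi_x => /eqP lx.
by rewrite cfkerEirr inE -/(lam x) lx lin_char1.
Qed.

(** * Characters that kill the kernel *)

Section KernelAnnihilator.
Variables (A : finZmodType) (phi : A -> A -> QZ).
Hypothesis phiP : is_alternate phi.

Lemma alternate_leftD b : {morph phi^~ b : x y / x + y}.
Proof. by move=> x y; apply: phiP.1.1. Qed.

Lemma alternate_rightD a : {morph phi a : x y / x + y}.
Proof. by move=> x y; apply: phiP.1.2. Qed.

Lemma kernelP a : reflect (forall b, phi a b = 0) (a \in kernel phi).
Proof.
by apply: (iffP (perpP phi setT a)) => h b; [apply: h; rewrite inE | move=> _].
Qed.

(* The phi(a, -) are already as many characters killing the kernel as [hom_count]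
   allows. *)
Lemma kernel_annihilator (psi : A -> QZ) :
  {morph psi : x y / x + y} -> {in kernel phi, forall a, psi a = 0} ->
  exists a, psi =1 phi a.
Proof.
have [K KE] : exists K : {group A}, K = kernel phi :> {set A}.
  by exists (Group (perp_group_set phiP setT)).
have KP x : reflect (forall b, phi x b = 0) (x \in K).
  by rewrite KE; apply: kernelP.
rewrite -KE => psiD psiK.
have [/existsP[a /forallP eqa]|/existsPn nopsi] :=
    boolP [exists a, [forall b, psi b == phi a b]].
  by exists a => b; apply/eqP.
(* If no [phi a] equals [psi], then [psi] and one [phi a] for each class modulo [K] are distinct
   characters killing [K], one more than [hom_count] allows. *)
pose Q := {c | c \in ([set: A]%G / K)%g}.
pose f (i : option Q) := if i is Some c then phi (repr (val c)) else psi.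
have /negP[] : ~~ (#|{: option Q}| * #|K| <= #|[set: A]%G|)%N.
  rewrite -ltnNge card_option card_sig card_quotient ?finzmod_norm //.
  by rewrite -(Lagrange (subsetT K)) mulnC ltn_pmul2r // cardG_gt0.
have neq c : ~ {in [set: A]%G, f (Some c) =1 f None}.
  move=> eqc; have /negP := nopsi (repr (val c)); apply.
  by apply/forallP=> b; rewrite -[psi b]/(f None b) -eqc ?inE.
apply: (@hom_count A [set: A]%G _ f K (subsetT _)).
- by case=> [c|] x y _ _; [apply: alternate_rightD | apply: psiD].
- case=> [c|] x Kx; last exact: psiK.
  by rewrite /f alternate_antisym // (KP x Kx) oppr0.
case=> [c|] [d|] //; first move=> cd; try by move/neq.
  congr Some; apply: val_inj.
  rewrite /= -(coset_reprK (val c)) -(coset_reprK (val d)).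
  rewrite -[repr (val c)](subrK (repr (val d))); apply: coset_kerl.
  apply/KP=> b.
  rewrite alternate_leftD (morphD_morphN (alternate_leftD b)).
  by apply/eqP; rewrite subr_eq0; apply/eqP/cd; rewrite inE.
by move=> eqd; case: (neq d) => b Gb; rewrite eqd.
Qed.

End KernelAnnihilator.

(** The first [p] multiples of [t] are distinct, and Q/Z has at most [p] elements killed by [p]. *)
Lemma QZ_torsion_multiple p (t u : QZ) :
  prime p -> t != 0 -> t *+ p = 0 -> u *+ p = 0 -> exists j, u = t *+ j.
Proof.
move=> pr_p t0 tp up; pose s := [seq t *+ j | j <- iota 0 p].
have [/mapP[j _ ->]|us] := boolP (u \in s); first by exists j.
have lt_inj i j : (i < j < p)%N -> t *+ i != t *+ j.
  case/andP=> ij jp; apply: contraNneq t0 => tij; apply/eqP.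
  have ji0 : t *+ (j - i) = 0 by rewrite mulrnBr 1?ltnW // tij subrr.
  apply: coprime_torsion0 ji0 tp; rewrite coprime_sym prime_coprime //.
  by rewrite gtnNdvd ?subn_gt0 // (leq_ltn_trans (leq_subr _ _)).
have : (size (u :: s) <= p)%N.
  apply: QZ_torsion_count; first exact: prime_gt0.
    rewrite /= us map_inj_in_uniq ?iota_uniq // => i j; rewrite !mem_iota => /= ip jp tij.
    case: (ltngtP i j) => // ltij.
      by have := lt_inj i j; rewrite ltij jp tij eqxx => /(_ isT).
    by have := lt_inj j i; rewrite ltij ip tij eqxx => /(_ isT).
  by move=> v; rewrite inE => /predU1P[->//|/mapP[j _ ->]]; rewrite mulrnAC tp mul0rn.
by rewrite /= size_map size_iota ltnn.
Qed.

(* The group generated by [A] and one more element [y] with [y *+ q.+1 = a0]: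
   the pair [(i, a)] stands for [y *+ i + a].  The unused argument [a0] keys the
   group structure, which depends on it. *)
Definition cyclic_ext (A : finZmodType) (q : nat) (a0 : A) : Type :=
  ('I_q.+1 * A)%type.

(** * Cyclic extensions of alternate modules *)

Section CyclicExtension.
Variables (A : finZmodType) (q : nat) (a0 : A).

Local Notation ext := (cyclic_ext q a0).
HB.instance Definition _ := Finite.on ext.

Implicit Types u v w : ext.

(** The carry of addition in base [q.+1]. It gives the 2-cocycle of the extension, since [q.+1]
    copies of [y] are traded for [a0]. *)
Definition ext_carry (i j : 'I_q.+1) : nat := ((i + j) %/ q.+1)%N.
Definition ext_add u v : ext :=
  (u.1 + v.1, u.2 + v.2 + a0 *+ ext_carry u.1 v.1).
Definition ext_zero : ext := (0, 0).
Definition ext_opp u : ext := (- u.1, - (u.2 + a0 *+ ext_carry (- u.1) u.1)).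

Lemma ext_carryC i j : ext_carry i j = ext_carry j i.
Proof. by rewrite /ext_carry addnC. Qed.

(** Both sides are the quotient of [i + j + k] by [q.+1]. Associativity of [ext_add] rests on
    this. *)
Lemma ext_carry_cocycle i j k :
  (ext_carry i j + ext_carry (i + j)%R k = ext_carry j k + ext_carry i (j + k)%R)%N.
Proof.
have carryE (x y : 'I_q.+1) (z : nat) :
    ((x + y) %/ q.+1 + ((x + y) %% q.+1 + z) %/ q.+1 = (x + y + z) %/ q.+1)%N.
  by rewrite -divnMDl // addnA -divn_eq.
by rewrite [ext_carry i (j + k)]ext_carryC /ext_carry /= !carryE [(j + k + i)%N]addnC addnA.
Qed.

Fact ext_addA : associative ext_add.
Proof.
move=> u v w; congr pair => /=; first by rewrite addrA.
rewrite -!addrA; congr (_ + (_ + _)).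
by rewrite [RHS]addrCA -!mulrnDr ext_carry_cocycle.
Qed.

Fact ext_addC : commutative ext_add.
Proof.
by move=> u v; rewrite /ext_add addrC [u.2 + _]addrC ext_carryC.
Qed.

Fact ext_add0 : left_id ext_zero ext_add.
Proof.
by case=> i a; rewrite /ext_add /ext_carry /= !add0r divn_small ?ltn_ord // mulr0n addr0.
Qed.

Fact ext_addN : left_inverse ext_zero ext_opp ext_add.
Proof.
case=> i a; rewrite /ext_add /ext_zero /= addNr opprD.
by rewrite -[X in (_, X)]addrA addrACA addNr addNr addr0.
Qed.

HB.instance Definition _ :=
  GRing.isZmodule.Build ext ext_addA ext_addC ext_add0 ext_addN.
HB.instance Definition _ := [finGroupMixin of ext for +%R].

Definition ext_inj (a : A) : ext := (0, a).

Lemma ext_inj_inj : injective ext_inj.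
Proof. by move=> a b []. Qed.

Lemma ext_injD : {morph ext_inj : a b / a + b}.
Proof.
move=> a b; congr pair; first by rewrite addr0.
by rewrite /ext_carry addn0 div0n mulr0n addr0.
Qed.

Variables (phi : A -> A -> QZ) (chi : A -> QZ).

(** Bilinearity and antisymmetry force this formula once [y] pairs to [0] with itself and to [chi b]
    with [b]. *)
Definition ext_form u v : QZ :=
  phi u.2 v.2 + chi v.2 *+ u.1 - chi u.2 *+ v.1.

Lemma ext_form_inj a b : ext_form (ext_inj a) (ext_inj b) = phi a b.
Proof. by rewrite /ext_form /= !mulr0n addr0 subr0. Qed.

Hypothesis phiP : is_alternate phi.
Hypothesis chiD : {morph chi : a b / a + b}.
Hypothesis chi_a0 : chi a0 = 0.
Hypothesis chi_phi : forall b, chi b *+ q.+1 = phi a0 b.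

(** A carry trades [q.+1] units of index for [a0]. By [chi_phi] this preserves the pairing with
    elements of [A], and by [chi_a0] the pairing with [y]. *)
Lemma ext_form_alternate : is_alternate ext_form.
Proof.
have anti u v : ext_form u v = - ext_form v u.
  rewrite /ext_form opprB [phi v.2 _]alternate_antisym //.
  by rewrite opprD opprK addrCA addrA.
have addl u v w : ext_form (u + v) w = ext_form u w + ext_form v w.
  rewrite /ext_form /= !(alternate_leftD phiP) !chiD !(morphD_morphMn _ (alternate_leftD phiP _)).
  rewrite -chi_phi !(morphD_morphMn _ chiD) chi_a0 mul0rn addr0.
  have carryE : chi w.2 *+ q.+1 *+ ext_carry u.1 v.1 + chi w.2 *+ (u.1 + v.1)%R
      = chi w.2 *+ u.1 + chi w.2 *+ v.1.
    by rewrite -mulrnA -!mulrnDr mulnC -divn_eq.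
  rewrite -[X in X - _]addrA carryE mulrnDl opprD.
  by rewrite [_ + (chi w.2 *+ _ + _)]addrACA [LHS]addrACA.
split; last by move=> u; rewrite /ext_form phiP.2 add0r subrr.
split=> // u v w; by rewrite anti addl opprD -!anti.
Qed.

Lemma card_cyclic_ext : #|{: ext}| = (q.+1 * #|A|)%N.
Proof. by rewrite card_prod card_ord. Qed.

Variable x : A.
Hypothesis pr_p : prime q.+1.
Hypothesis Kx : x \in kernel phi.
Hypothesis chi_x : chi x != 0.
Hypothesis chi_xp : chi x *+ q.+1 = 0.

Let extP := ext_form_alternate.
Let E : {set ext} := [set u | u.1 == 0].

Fact ext_base_group_set : group_set E.
Proof.
apply/group_setP; split; first by rewrite inE.
by move=> u v; rewrite !inE /= => /eqP-> /eqP->; rewrite addr0.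
Qed.

Let ext_form_x u : ext_form u (ext_inj x) = chi x *+ u.1.
Proof.
rewrite /ext_form /= mulr0n subr0 (alternate_antisym phiP).
by rewrite (kernelP phi x Kx) oppr0 add0r.
Qed.

Let ext_form_x_eq0 u : ext_form u (ext_inj x) = 0 -> u \in E.
Proof.
rewrite ext_form_x inE => cu; apply: contraNT chi_x => u1.
apply/eqP/(coprime_torsion0 _ cu chi_xp).
by rewrite coprime_sym prime_coprime // gtnNdvd // lt0n.
Qed.

(** [E] contains [ext_inj x], and orthogonality to it forces index zero because [chi x] has order
    [q.+1]; what remains is orthogonality inside [A]. *)
Lemma ext_base_perp : perp ext_form E = ext_inj @: kernel phi.
Proof.
have Ex : ext_inj x \in E by rewrite inE.
apply/setP=> u; apply/(perpP ext_form E u)/imsetP => [uE|[a /kernelP Ka ->] v].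
  have := ext_form_x_eq0 (uE _ Ex); case: u uE => i a uE; rewrite inE => /= /eqP i0.
  rewrite {}i0 in uE *; exists a => //; apply/kernelP=> b.
  by rewrite -ext_form_inj uE ?inE.
by rewrite inE /ext_form /= Ka => /eqP->; rewrite !mulr0n addr0 subr0.
Qed.

(** Both inequalities are [pairing_card] applied to [E], a copy of [A], and its orthogonal, a copy
    of [kernel phi]. The orthogonal of the latter is [E] again because it contains [ext_inj x]. *)
Lemma ext_kernel_card :
  (#|{: ext}| * #|kernel ext_form| = #|A| * #|kernel phi|)%N.
Proof.
pose G := Group ext_base_group_set.
pose P := Group (perp_group_set extP E).
pose K := Group (perp_group_set extP setT).
have cG : #|G| = #|A|.
  rewrite -(card_imset _ ext_inj_inj); apply: eq_card => -[i a].
  by rewrite inE /=; apply/eqP/imsetP => [->|[b _ [-> _]] //]; exists a.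
have cP : #|P| = #|kernel phi|.
  by rewrite -(card_imset _ ext_inj_inj) -ext_base_perp.
have Px : ext_inj x \in P by rewrite /= ext_base_perp imset_f.
have sKP : K \subset P.
  apply/subsetP=> u /perpP uT; apply/perpP=> v _; exact: uT.
have anti u v : ext_form u v = 0 -> ext_form v u = 0.
  by move=> uv; rewrite (alternate_antisym extP) uv oppr0.
rewrite -cG -cP -cardsT; apply/eqP; rewrite eqn_leq; apply/andP; split.
  apply: (@pairing_card _ _ extP [set: ext]%G G P K) => //; first exact: subsetT.
    by move=> u v _ /perpP vT; apply/anti/vT.
  move=> u _; apply/idP/forall_inP => [Gu v /perpP vE|uP]; first by apply/eqP/anti/vE.
  exact/ext_form_x_eq0/eqP/uP.
rewrite mulnC [leqRHS]mulnC; apply: (@pairing_card _ _ extP P K [set: ext]%G G) => //.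
  exact: subsetT.
  by move=> u v /perpP uE /uE.
by move=> u _; rewrite inE.
Qed.

End CyclicExtension.

(** * Embedding into a nondegenerate module *)

Lemma kernel_character (A : finZmodType) (phi : A -> A -> QZ) :
  is_alternate phi -> (1 < #|kernel phi|)%N ->
  exists p (a0 x : A) (chi : A -> QZ),
  [/\ prime p, {morph chi : a b / a + b}, chi a0 = 0 &
      (forall b, chi b *+ p = phi a0 b)] /\
  [/\ x \in kernel phi, chi x != 0 & chi x *+ p = 0].
Proof.
move=> phiP K_gt1; pose K := Group (perp_group_set phiP setT).
pose p := pdiv #|kernel phi|; have pr_p : prime p := pdiv_prime K_gt1.
have pKgrp : group_set [set a *+ p | a in K].
  apply/group_setP; split; first by apply/imsetP; exists 0; rewrite ?group1 ?mul0rn.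
  move=> _ _ /imsetP[a Ka ->] /imsetP[b Kb ->].
  by apply/imsetP; exists (a + b); [apply: (groupM Ka Kb) | rewrite mulrnDl].
(* If every element of [K] were [p] times another, multiplication by [p] would be injective on [K],
   against Cauchy's theorem. *)
have [x Kx pKx] : exists2 x, x \in K & x \notin Group pKgrp.
  apply/subsetPn; apply/negP => sKpK.
  have [z Kz oz] := Cauchy pr_p (pdiv_dvd #|kernel phi| : (p %| #|K|)%N).
  have /imset_injP inj_p : #|[set a *+ p | a in K]| == #|K|.
    by rewrite eqn_leq leq_imset_card subset_leq_card.
  have z0 : z = 0.
    apply: inj_p; rewrite ?group1 //= mul0rn -FinRing.zmodXgE -oz.
    exact: expg_order.
  by have := prime_gt1 pr_p; rewrite -oz z0 order1.
have [chi [chiD chi_pK chi_x]] := separating_character pKx.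
have chi_p a : a \in K -> chi a *+ p = 0.
  by move=> Ka; rewrite -(morphD_morphMn p chiD) chi_pK //; apply: imset_f.
have [a1 a1P] : exists a, (fun b => chi b *+ p) =1 phi a.
  by apply: kernel_annihilator => // a b; rewrite chiD mulrnDl.
(* Since [chi a1 *+ p = phi a1 a1 = 0], both values are killed by [p]. Subtracting [x *+ j] from
   [a1] makes [chi] vanish there and keeps [phi a1], as [x] is in the kernel. *)
have [j chi_a1] : exists j, chi a1 = chi x *+ j.
  by apply: (QZ_torsion_multiple pr_p chi_x (chi_p x Kx)); rewrite a1P phiP.2.
exists p, (a1 - x *+ j), x, chi; split; split=> //; last exact: chi_p.
  by rewrite chiD (morphD_morphN chiD) (morphD_morphMn _ chiD) chi_a1 subrr.
move=> b; have phiD := alternate_leftD phiP b.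
by rewrite phiD (morphD_morphN phiD) (morphD_morphMn _ phiD) (kernelP phi x Kx)
  mul0rn oppr0 addr0 a1P.
Qed.

(** Induction on the order of the kernel: a cyclic extension keeps the product of the orders of
    module and kernel, and multiplies the former by a prime. *)
Lemma nondegenerate_embedding (A : finZmodType) (phi : A -> A -> QZ) :
  is_alternate phi ->
  exists (W : finZmodType) (psi : W -> W -> QZ) (h : A -> W),
  [/\ is_alternate psi, kernel psi = [set 0] & #|W| = (#|A| * #|kernel phi|)%N] /\
  [/\ {morph h : a b / a + b}, injective h & forall a b, psi (h a) (h b) = phi a b].
Proof.
have [n] := ubnP #|kernel phi|; elim: n => // n IHn in A phi *.
rewrite ltnS => le_Kn phiP; have [K_gt1|K_le1] := ltnP 1 #|kernel phi|; last first.
  have K0 : kernel phi = [set 0].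
    apply/esym/eqP; rewrite eqEcard cards1 K_le1 andbT sub1set.
    exact: (group1 (Group (perp_group_set phiP setT))).
  by exists A, phi, id; rewrite K0 cards1 muln1; split; split.
have [[|q] [a0 [x [chi [[pr_p chiD chi_a0 chi_phi] [Kx chi_x chi_xp]]]]]] :=
  kernel_character phiP K_gt1.
  by move: pr_p.
have extP := ext_form_alternate phiP chiD chi_a0 chi_phi.
have eqK := ext_kernel_card phiP chiD chi_a0 chi_phi pr_p Kx chi_x chi_xp.
have ltK : (#|kernel (@ext_form A q a0 phi chi)| < n)%N.
  apply: leq_trans le_Kn.
  have A_gt0 : (0 < #|A|)%N by apply/card_gt0P; exists 0.
  have : (0 < #|A| * #|kernel phi|)%N by rewrite muln_gt0 A_gt0 (ltnW K_gt1).
  rewrite -eqK muln_gt0 => /andP[_ K'_gt0].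
  rewrite -(ltn_pmul2l A_gt0) -eqK ltn_pmul2r // card_cyclic_ext.
  by rewrite -[ltnLHS]mul1n ltn_pmul2r // prime_gt1.
have [W [psi [h [[psiP psi0 cW] [hD h_inj h_phi]]]]] := IHn _ _ ltK extP.
exists W, psi, (h \o @ext_inj A q a0); split; split=> //.
- by rewrite cW eqK.
- by move=> a b; rewrite /= ext_injD hD.
- exact: inj_comp h_inj (@ext_inj_inj _ _ _).
- by move=> a b; rewrite /= h_phi ext_form_inj.
Qed.

(** * Hyperbolic pairs in a nondegenerate module *)

Section Hyperbolic.
Variables (A : finZmodType) (phi : A -> A -> QZ).
Hypothesis phiP : is_alternate phi.
Hypothesis phi_nondeg : kernel phi = [set 0].

Implicit Types L M : {group A}.

Let perp_group S := Group (perp_group_set phiP S).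

Lemma mem_joinP L M z :
  reflect (exists2 l, l \in L & exists2 m, m \in M & z = l + m)
          (z \in L <*> M)%g.
Proof.
rewrite norm_joinEr ?finzmod_norm //; apply: (iffP mulsgP) => [[l m Ll Mm ->]|[l Ll [m Mm ->]]].
  by exists l => //; exists m.
by exists l m.
Qed.

(** Isotropic subgroups, each embedded by the form in the dual of the other, hence in perfect
    duality. *)
Definition hyperbolic L M : bool :=
  [&& L \subset perp phi L, M \subset perp phi M,
      L :&: perp phi M \subset [set 0] & M :&: perp phi L \subset [set 0]].

Lemma hyperbolicC L M : hyperbolic L M = hyperbolic M L.
Proof. by rewrite /hyperbolic andbCA [X in _ && (_ && X)]andbC. Qed.

(** Pairing [l + m] with [M] sees only [l], and pairing it with [L] sees only [m]. *)
Lemma hyperbolic_trivial_perp L M :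
  hyperbolic L M -> (L <*> M)%g :&: perp phi (L :|: M) \subset [set 0].
Proof.
case/and4P=> isoL isoM LM0 ML0; apply/subsetP=> _ /setIP[/mem_joinP[l Ll [m Mm ->]]].
move/perpP=> lmP.
have /set1P-> : l \in [set 0].
  apply: (subsetP LM0); rewrite inE Ll; apply/perpP=> z Mz.
  have := lmP z; rewrite inE Mz orbT => /(_ isT).
  by rewrite alternate_leftD // (perpP _ _ _ (subsetP isoM m Mm)) // addr0.
rewrite add0r; apply: (subsetP ML0); rewrite inE Mm; apply/perpP=> z Lz.
have := lmP z; rewrite inE Lz => /(_ isT).
by rewrite alternate_leftD // (perpP _ _ _ (subsetP isoL l Ll)) // add0r.
Qed.

(** The two factors meet trivially, and [pairing_card] with trivial [N] bounds the product of their
    orders below by [#|A|]. *)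
Lemma hyperbolic_decomposition L M :
  hyperbolic L M -> ((L <*> M) * perp phi (L :|: M))%g = [set: A].
Proof.
move=> hLM; pose D := perp_group (L :|: M); pose H := (L <*> M)%G.
have tiHD : H :&: D = 1%g.
  apply/trivgP; exact: (hyperbolic_trivial_perp hLM).
apply/eqP; rewrite eqEcard subsetT /= [leqRHS](TI_cardMg tiHD) mulnC.
have := @pairing_card _ _ phiP [set: A]%G D H 1%G; rewrite cards1 muln1; apply=> //.
- exact: sub1G.
- exact: subsetT.
- move=> a x _ /set1P->; exact: (morphD_morph0 (alternate_rightD phiP a)).
move=> a _; apply/perpP/forall_inP => [aP z /mem_joinP[l Ll [m Mm ->]]|aH z].
  by rewrite alternate_rightD // !aP ?addr0 // inE ?Ll ?Mm ?orbT.
by move=> LMz; apply/eqP/aH; apply: subsetP LMz; rewrite sub_gen.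
Qed.

Lemma hyperbolic_perp_nondegenerate L M a :
  hyperbolic L M -> a \in perp phi (L :|: M) ->
  {in perp phi (L :|: M), forall b, phi a b = 0} -> a = 0.
Proof.
move=> hLM /perpP aLM aD; apply/set1P; rewrite -phi_nondeg; apply/kernelP=> z.
have : z \in ((L <*> M) * perp phi (L :|: M))%g by rewrite hyperbolic_decomposition // inE.
case/mulsgP=> _ d /mem_joinP[l Ll [m Mm ->]] Dd ->.
by rewrite FinRing.zmodMgE !(alternate_rightD phiP) (aD d) // !aLM ?addr0 // inE ?Ll ?Mm ?orbT.
Qed.

(* Take x of order the exponent e of the orthogonal D, a prime p dividing e and y
   in D with phi((e/p) x, y) <> 0; the p-primary parts of x and y will do. *)
Lemma perp_hyperbolic_pair L M :
  hyperbolic L M -> ~~ (perp phi (L :|: M) \subset [set 0]) ->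
  exists x y d, [/\ x \in perp phi (L :|: M), y \in perp phi (L :|: M),
    x != 0, x *+ d = 0 /\ y *+ d = 0 &
    forall i, phi x y *+ i = 0 -> (d %| i)%N].
Proof.
move=> hLM ntD; pose D := perp_group (L :|: M).
have abD : abelian D by apply/centsP=> a _ b _; apply: addrC.
have [x Dx ex] := exponent_witness (abelian_nil abD).
set e := exponent D in ex.
have e_gt1 : (1 < e)%N.
  rewrite ltn_neqAle exponent_gt0 andbT eq_sym.
  apply: contra ntD => /eqP e1.
  by rewrite -[perp _ _]/(gval D) -[[set 0]]/(1%g : {set A}) subG1 trivg_exponent -/e e1.
pose p := pdiv e; have pr_p : prime p := pdiv_prime e_gt1.
have eD a : a \in D -> a *+ e = 0.
  by move=> Da; rewrite -FinRing.zmodXgE expg_exponent.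
pose f := (e %/ p)%N; have ef : (e = f * p)%N by rewrite divnK ?pdiv_dvd.
have xf : x *+ f != 0.
  rewrite -FinRing.zmodXgE -[0]/(1%g : A) -order_dvdn -ex; apply/negP => /dvdn_leq.
  have f_gt0 : (0 < f)%N by rewrite divn_gt0 ?pdiv_gt0 // pdiv_leq // ltnW.
  by rewrite f_gt0 leqNgt ltn_Pdiv ?prime_gt1 // ?(ltnW e_gt1) // => /(_ isT).
have [y Dy phi_xfy] : exists2 y, y \in D & phi (x *+ f) y != 0.
  apply/exists_inP; apply: contraR xf => /exists_inPn xfD; apply/eqP.
  apply: (hyperbolic_perp_nondegenerate hLM); first exact: (groupX f Dx).
  by move=> b Db; apply/eqP; have := xfD b Db; rewrite negbK.
(* [m] is the prime-to-[p] part of [e], so that [e = p ^ k.+1 * m] and [f = p ^ k * m]; multiplying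
   by [m] lands in the [p]-primary part. *)
pose m := (e`_p^')%N; pose k := (logn p e).-1.
have e_gt0 : (0 < e)%N by apply: ltnW.
have ek : (e = p ^ k.+1 * m)%N.
  rewrite prednK ?logn_gt0 ?mem_primes ?pr_p ?e_gt0 ?pdiv_dvd //.
  by rewrite -p_part partnC.
have fk : (f = p ^ k * m)%N.
  by rewrite /f ek expnS -mulnA mulKn // prime_gt0.
have phiMl a b n : phi (a *+ n) b = phi a b *+ n.
  exact: (morphD_morphMn n (alternate_leftD phiP b)).
have phiMr a b n : phi a (b *+ n) = phi a b *+ n.
  exact: (morphD_morphMn n (alternate_rightD phiP a)).
have co_mp : coprime m p by rewrite coprime_sym prime_coprime // -p'natE // part_pnat.
(* This value is [phi (x *+ f) y *+ m], where the nonzero [phi (x *+ f) y] is killed by [p] and [m]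
   is prime to [p]. *)
have phi_ne0 : phi (x *+ m) (y *+ m) *+ (p ^ k) != 0.
  rewrite phiMl phiMr -!mulrnA [(m * _)%N in X in (_ * X)%N]mulnC.
  apply: contra phi_xfy => /eqP t0; apply/eqP/(coprime_torsion0 co_mp).
    by rewrite phiMl -mulrnA fk mulnC.
  by rewrite -phiMl -mulrnA -ef eD //; apply: (morphD_morph0 (alternate_leftD phiP y)).
have em0 a : a \in D -> a *+ m *+ (p ^ k.+1) = 0.
  by move=> Da; rewrite -mulrnA mulnC -ek eD.
exists (x *+ m), (y *+ m), (p ^ k.+1)%N; split.
- exact: (groupX m Dx).
- exact: (groupX m Dy).
- apply: contra phi_ne0 => /eqP->.
  by rewrite (morphD_morph0 (alternate_leftD phiP _)) mul0rn.
- by split; apply: em0.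
move=> i; apply: prime_power_torsion_dvdn => //.
by rewrite -phiMl em0 // (morphD_morph0 (alternate_leftD phiP _)).
Qed.

(** One half of the hyperbolicity of the enlarged pair; exchanging the roles gives the other. For
    [l + x *+ i], pairing with [M] forces [l = 0], then pairing with [y] forces [d] to divide
    [i]. *)
Lemma hyperbolic_extendl L M x y d :
  x \in perp phi (L :|: M) -> y \in perp phi (L :|: M) ->
  x *+ d = 0 -> (forall i, phi x y *+ i = 0 -> (d %| i)%N) ->
  hyperbolic L M ->
  (L <*> <[x]>)%g \subset perp phi (L <*> <[x]>)%g /\
  (L <*> <[x]>)%g :&: perp phi (M <*> <[y]>)%g \subset [set 0].
Proof.
move=> /perpP xP /perpP yP xd ndiv /and4P[/subsetP isoL _ /subsetP LM0 _].
have phiMl a b n : phi (a *+ n) b = phi a b *+ n.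
  exact: (morphD_morphMn n (alternate_leftD phiP b)).
have phiMr a b n : phi a (b *+ n) = phi a b *+ n.
  exact: (morphD_morphMn n (alternate_rightD phiP a)).
have xL l : l \in L -> phi x l = 0 by move=> Ll; rewrite xP // inE Ll.
have xM m : m \in M -> phi x m = 0 by move=> Mm; rewrite xP // inE Mm orbT.
have Ly l : l \in L -> phi l y = 0.
  by move=> Ll; rewrite alternate_antisym // yP ?oppr0 // inE Ll.
split; apply/subsetP=> z.
  case/mem_joinP=> l Ll [_ /cycleP[i ->] ->].
  apply/perpP=> _ /mem_joinP[l' Ll' [_ /cycleP[j ->] ->]].
  rewrite !FinRing.zmodXgE !(alternate_leftD phiP) !(alternate_rightD phiP) !phiMl !phiMr.
  rewrite phiP.2 xL // [phi l x]alternate_antisym // xL // oppr0 !mul0rn !addr0.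
  by rewrite (perpP _ _ _ (isoL l Ll)).
case/setIP=> /mem_joinP[l Ll [_ /cycleP[i ->] ->]] /perpP zP.
have /set1P l0 : l \in [set 0].
  apply: LM0; rewrite inE Ll; apply/perpP=> m Mm.
  have := zP m; rewrite FinRing.zmodXgE (alternate_leftD phiP) phiMl xM // mul0rn addr0; apply.
  by rewrite mem_gen // inE Mm.
have /ndiv/dvdnP[c ->] : phi x y *+ i = 0.
  have := zP y; rewrite l0 add0r FinRing.zmodXgE phiMl; apply.
  by rewrite mem_gen // inE cycle_id orbT.
by rewrite l0 FinRing.zmodXgE mulnC mulrnA xd mul0rn addr0 inE.
Qed.

Lemma hyperbolic_extend L M :
  hyperbolic L M -> ~~ (perp phi (L :|: M) \subset [set 0]) ->
  exists L' M' : {group A}, hyperbolic L' M' /\ (#|L| < #|L'|)%N.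
Proof.
move=> hLM /(perp_hyperbolic_pair hLM)[x [y [d [Px Py x0 [xd yd] ndiv]]]].
have [isoL LM0] := hyperbolic_extendl Px Py xd ndiv hLM.
have [isoM ML0] : (M <*> <[y]>)%g \subset perp phi (M <*> <[y]>)%g /\
    (M <*> <[y]>)%g :&: perp phi (L <*> <[x]>)%g \subset [set 0].
  apply: (@hyperbolic_extendl M L y x d); rewrite 1?setUC //.
    by move=> i; rewrite alternate_antisym // mulNrn => /eqP; rewrite oppr_eq0 => /eqP/ndiv.
  by rewrite hyperbolicC.
exists (L <*> <[x]>)%G, (M <*> <[y]>)%G; split; first exact/and4P.
apply: proper_card; rewrite properE joing_subl /=; apply/subsetPn; exists x.
  by rewrite mem_gen // inE cycle_id orbT.
apply: contra x0 => Lx; have := hyperbolic_trivial_perp hLM.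
move/subsetP/(_ x); rewrite inE => h; apply/eqP/set1P/h; rewrite Px andbT.
by rewrite mem_gen // inE Lx.
Qed.

Lemma hyperbolic_splitting : exists L M : {group A},
  [/\ lagrangian phi L, M \subset perp phi M, L :&: M = [set 0] &
      forall a, exists2 l, l \in L & a - l \in M].
Proof.
have h0 : hyperbolic 1%G 1%G.
  have iso1 : 1%G \subset perp phi 1%G by exact: (sub1G (perp_group 1%g)).
  by apply/and4P; split; rewrite ?iso1 // subsetIl.
pose P (LM : {group A} * {group A}) := hyperbolic LM.1 LM.2.
have := @arg_maxnP _ (1%G, 1%G) P (fun LM => #|LM.1|) h0.
case=> -[L M] /= hLM maxL.
have D0 : perp phi (L :|: M) \subset [set 0].
  apply: contraT => /(hyperbolic_extend hLM)[L' [M' [hLM' ltL]]].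
  by have := maxL (L', M') hLM'; rewrite leqNgt ltL.
have dec a : exists2 l, l \in L & a - l \in M.
  have : a \in ((L <*> M) * perp phi (L :|: M))%g by rewrite hyperbolic_decomposition // inE.
  case/mulsgP=> _ d /mem_joinP[l Ll [m Mm ->]] /(subsetP D0)/set1P-> ->.
  by exists l => //; rewrite FinRing.zmodMgE addr0 addrAC subrr add0r.
case/and4P: (hLM) => isoL isoM LM0 ML0.
have tiLM : L :&: M = [set 0].
  apply/eqP; rewrite eqEsubset sub1set (group1 (L :&: M)%G) andbT.
  by apply: subset_trans LM0; rewrite setIS.
exists L, M; split=> //; rewrite /lagrangian eqEsubset isoL /=.
(* If [a] is orthogonal to [L], so is its [M]-component [a - l], which must then vanish by
   duality. *)
apply/subsetP=> a /perpP aL; have [l Ll Mal] := dec a.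
rewrite -(subrK l a); suff /set1P-> : a - l \in [set 0] by rewrite add0r.
apply: (subsetP ML0); rewrite inE Mal; apply/perpP=> z Lz.
rewrite (alternate_leftD phiP) (morphD_morphN (alternate_leftD phiP z)) aL //.
by rewrite (perpP _ _ _ (subsetP isoL l Ll)) // subr0.
Qed.

End Hyperbolic.

(** * Isometry with the standard symplectic module *)

Section Subgroup.
Variables (A : finZmodType) (L : {group A}).

Definition in_subgroup : pred A := fun a => a \in L.

Fact in_subgroup_zmod_closed : zmod_closed in_subgroup.
Proof.
split=> [|a b La Lb]; first exact: (group1 L).
by apply: (groupM La); rewrite -FinRing.zmodVgE; apply: groupVr.
Qed.
HB.instance Definition _ :=
  GRing.isZmodClosed.Build A in_subgroup in_subgroup_zmod_closed.

Record subgroup := Subgroup { subgroup_val :> A; _ : in_subgroup subgroup_val }.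
HB.instance Definition _ := [isSub for subgroup_val].
HB.instance Definition _ := [Countable of subgroup by <:].
HB.instance Definition _ := [Finite of subgroup by <:].
HB.instance Definition _ := [SubChoice_isSubZmodule of subgroup by <:].

Lemma card_subgroup : #|{: subgroup}| = #|L|.
Proof. by rewrite card_sub; apply: eq_card. Qed.

End Subgroup.

(** Write [a = l a + m a] and send [a] to [l a] and the character [psi^~ (m a)] of [L]. As [L] and
    [M] are isotropic, only the cross terms of [psi a b] survive, and they add up to [omega]. *)
Lemma lagrangian_splitting_isometry (W : finZmodType) (psi : W -> W -> QZ)
    (L M : {group W}) :
  is_alternate psi -> lagrangian psi L -> M \subset perp psi M ->
  L :&: M = [set 0] -> (forall a, exists2 l, l \in L & a - l \in M) ->
  exists2 iota : W -> subgroup L * dual (subgroup L),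
    {morph iota : a b / a + b} & forall a b, omega (iota a) (iota b) = psi a b.
Proof.
move=> psiP /eqP lagL isoM tiLM /fin_all_exists2[l Ll Ml].
pose m a := a - l a.
have psiL x y : x \in L -> y \in L -> psi x y = 0.
  by rewrite {1}lagL => /perpP; apply.
have psiM x y : x \in M -> y \in M -> psi x y = 0.
  by move=> Mx; apply: (perpP _ _ _ (subsetP isoM x Mx)).
have psiDl := alternate_leftD psiP; have psiDr := alternate_rightD psiP.
have subL := (in_subgroup_zmod_closed L).2.
have subM := (in_subgroup_zmod_closed M).2.
(* The component [l a] was merely chosen; trivial intersection makes it unique, hence additive in
   [a]. *)
have uniq_l a x y : x \in L -> y \in L -> a - x \in M -> a - y \in M -> x = y.
  move=> Lx Ly Mx My; apply/eqP; rewrite -subr_eq0; apply/eqP/set1P.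
  rewrite -tiLM inE; apply/andP; split; first exact: subL.
  have -> : x - y = (a - y) - (a - x) by rewrite opprB [RHS]addrC addrA subrK.
  exact: subM.
have lD : {morph l : a b / a + b}.
  move=> a b; apply: (uniq_l (a + b)) => //; first exact: (groupM (Ll a) (Ll b)).
  by rewrite opprD addrACA; apply: (groupM (Ml a) (Ml b)).
have mD : {morph m : a b / a + b}.
  by move=> a b; rewrite /m lD opprD addrACA.
have hom_m a : is_hom [ffun x : subgroup L => psi (val x) (m a)].
  by apply/is_homP=> x y; rewrite !ffunE psiDl.
exists (fun a => (Subgroup (Ll a), Dual (hom_m a))).
  move=> a b; congr pair; apply: val_inj; first exact: lD.
  by apply/ffunP=> x; rewrite /= !ffunE mD psiDr.
move=> a b; rewrite /omega /= !ffunE /= (alternate_antisym psiP (l b)) opprK.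
rewrite -[in RHS](subrK (l a) a) -[in RHS](subrK (l b) b) -/(m a) -/(m b).
rewrite (psiDl _ (m a) (l a)) !(psiDr _ (m b) (l b)) (psiM (m a) (m b) (Ml a) (Ml b)).
by rewrite (psiL (l a) (l b)) // add0r addr0 addrC.
Qed.

Theorem mainTheorem1 (A : finZmodType) (phi : A -> A -> QZ)
    (phi_alt : is_alternate phi) : subsymplectic phi.
Proof.
have [W [psi [h [[psiP psi0 cW] [hD h_inj h_phi]]]]] := nondegenerate_embedding phi_alt.
have [L [M [lagL isoM tiLM dec]]] := hyperbolic_splitting psiP psi0.
have [iota iotaD iota_psi] := lagrangian_splitting_isometry psiP lagL isoM tiLM dec.
exists (subgroup L).
  (* The squares agree: [W] has order [#|A| * #|kernel phi|], and [psi] has trivial kernel. *)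
  apply/eqP; rewrite card_subgroup -eqn_sqr (lagr_order_sqrt phi_alt).
  by rewrite (lagrangian_card psiP lagL) psi0 cards1 muln1 cW.
have additive_f : zmod_morphism (iota \o h).
  by move=> a b; rewrite /= hD iotaD (morphD_morphN hD) (morphD_morphN iotaD).
pose f : {additive A -> subgroup L * dual (subgroup L)} :=
  HB.pack (iota \o h) (GRing.isZmodMorphism.Build _ _ _ additive_f).
exists f; last by move=> a b; rewrite iota_psi h_phi.
(* [iota] preserves the form and [psi] is nondegenerate, so [iota] is injective. *)
apply: inj_comp h_inj => a b eq_ab; apply/eqP; rewrite -subr_eq0.
apply/eqP/set1P; rewrite -psi0; apply/kernelP=> c.
by rewrite (alternate_leftD psiP) (morphD_morphN (alternate_leftD psiP c)) -!iota_psi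
  eq_ab subrr.
Qed.
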